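(* An equational basis for $V(\mathbb{AOL})$ relative to $\mathbb{PBZL}^{\ast}$ is given by the single identity $$x\approx(x\wedge y^{\sim})\vee(x\wedge\Diamond y).$$ That is, a PBZ$^{\ast}$-lattice belongs to $V(\mathbb{AOL})$ if and only if it satisfies this identity.
   Context: A bounded involution lattice is an algebra $(L,\wedge,\vee,{}^{\prime},0,1)$ such that $(L,\wedge,\vee,0,1)$ is a bounded lattice, $a^{\prime\prime}=a$, and $a\leq b$ implies $b^{\prime}\leq a^{\prime}$. It is a pseudo-Kleene algebra if $a\wedge a^{\prime}\leq b\vee b^{\prime}$ for all $a,b$. A BZ-lattice is an algebra $\mathbf{L}=(L,\wedge,\vee,{}^{\prime},{}^{\sim},0,1)$ whose reduct without ${}^{\sim}$ is a pseudo-Kleene algebra and such that for all $a,b\in L$: $a\wedge a^{\sim}=0$; $a\leq a^{\sim\sim}$; $a\leq b$ implies $b^{\sim}\leq a^{\sim}$; $a^{\sim\prime}=a^{\sim\sim}$. Write $\Diamond x=x^{\sim\sim}$ and $\square x=x^{\prime\sim}$. A PBZ$^{\ast}$-lattice is a BZ-lattice satisfying $(a\wedge a^{\prime})^{\sim}\leq a^{\sim}\vee\square a$ for all $a$, and which is paraorthomodular: $a\leq b$ and $a^{\prime}\wedge b=0$ imply $a=b$. PBZ$^{\ast}$-lattices form a variety $\mathbb{PBZL}^{\ast}$. An antiortholattice is a PBZ$^{\ast}$-lattice $\mathbf{L}$ with $\{a\in L: a\wedge a^{\prime}=0\}=\{0,1\}$; $\mathbb{AOL}$ is the class of antiortholattices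 and $V(\mathbb{AOL})$ the variety it generates. *)

(* Defs.v *)
Set Implicit Arguments.
Unset Strict Implicit.
Unset Printing Implicit Defensive.

(* Algebras of type (2,2,1,1,0,0): [kneg] is the involution ', [bneg] is ~.
   A bare signature, with the axioms as predicates on it, because generating
   a variety quantifies over arbitrary classes of algebras of this type. *)
Record algebra : Type := Algebra {
  carrier :> Type;
  meet : carrier -> carrier -> carrier;
  join : carrier -> carrier -> carrier;
  kneg : carrier -> carrier;
  bneg : carrier -> carrier;
  bot : carrier;
  top : carrier
}.

Arguments meet {a} _ _.
Arguments join {a} _ _.
Arguments kneg {a} _.
Arguments bneg {a} _.
Arguments bot {a}.
Arguments top {a}.

Declare Scope bz_scope.
Delimit Scope bz_scope with bz.
Open Scope bz_scope.

Notation "x ⊓ y" := (meet x y) (at level 40, left associativity) : bz_scope.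
Notation "x ⊔ y" := (join x y) (at level 50, left associativity) : bz_scope.

Definition le {L : algebra} (x y : L) : Prop := x ⊓ y = x.
Notation "x ⊑ y" := (le x y) (at level 70, no associativity) : bz_scope.

Definition diamond {L : algebra} (x : L) : L := bneg (bneg x).
Definition box {L : algebra} (x : L) : L := bneg (kneg x).

Record bounded_lattice (L : algebra) : Prop := {
  meetA : forall x y z : L, x ⊓ (y ⊓ z) = (x ⊓ y) ⊓ z;
  meetC : forall x y : L, x ⊓ y = y ⊓ x;
  joinA : forall x y z : L, x ⊔ (y ⊔ z) = (x ⊔ y) ⊔ z;
  joinC : forall x y : L, x ⊔ y = y ⊔ x;
  meet_joinK : forall x y : L, x ⊓ (x ⊔ y) = x;
  join_meetK : forall x y : L, x ⊔ (x ⊓ y) = x;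
  bot_le : forall x : L, bot ⊑ x;
  le_top : forall x : L, x ⊑ top
}.

Record bounded_involution_lattice (L : algebra) : Prop := {
  bil_lattice :> bounded_lattice L;
  knegK : forall a : L, kneg (kneg a) = a;
  kneg_anti : forall a b : L, a ⊑ b -> kneg b ⊑ kneg a
}.

Record pseudo_kleene (L : algebra) : Prop := {
  pk_involution :> bounded_involution_lattice L;
  kleene : forall a b : L, a ⊓ kneg a ⊑ b ⊔ kneg b
}.

Record bz_lattice (L : algebra) : Prop := {
  bz_pseudo_kleene :> pseudo_kleene L;
  meet_bneg : forall a : L, a ⊓ bneg a = bot;
  le_diamond : forall a : L, a ⊑ bneg (bneg a);
  bneg_anti : forall a b : L, a ⊑ b -> bneg b ⊑ bneg a;
  kneg_bneg : forall a : L, kneg (bneg a) = bneg (bneg a)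
}.

Definition paraorthomodular (L : algebra) : Prop :=
  forall a b : L, a ⊑ b -> kneg a ⊓ b = bot -> a = b.

Record pbzs_lattice (L : algebra) : Prop := {
  pbzs_bz :> bz_lattice L;
  pbzs_star : forall a : L, bneg (a ⊓ kneg a) ⊑ bneg a ⊔ box a;
  pbzs_paraorthomodular : paraorthomodular L
}.

Record antiortholattice (L : algebra) : Prop := {
  aol_pbzs :> pbzs_lattice L;
  aol_sharp : forall a : L, a ⊓ kneg a = bot <-> a = bot \/ a = top
}.

Record homomorphism (A B : algebra) (f : A -> B) : Prop := {
  hom_meet : forall x y : A, f (x ⊓ y) = f x ⊓ f y;
  hom_join : forall x y : A, f (x ⊔ y) = f x ⊔ f y;
  hom_kneg : forall x : A, f (kneg x) = kneg (f x);
  hom_bneg : forall x : A, f (bneg x) = bneg (f x);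
  hom_bot : f bot = bot;
  hom_top : f top = top
}.

Definition injective_map (A B : Type) (f : A -> B) : Prop :=
  forall x y : A, f x = f y -> x = y.

Definition surjective_map (A B : Type) (f : A -> B) : Prop :=
  forall y : B, exists x : A, f x = y.

Definition product (I : Type) (A : I -> algebra) : algebra := {|
  carrier := forall i : I, A i;
  meet := fun x y i => x i ⊓ y i;
  join := fun x y i => x i ⊔ y i;
  kneg := fun x i => kneg (x i);
  bneg := fun x i => bneg (x i);
  bot := fun _ => bot;
  top := fun _ => top
|}.

(* A class closed under H, S and P. Subalgebras are given by embeddings, so
   closure under isomorphic copies is included (as it is in closure under H). *)
Record variety (V : algebra -> Prop) : Prop := {
  variety_H : forall (A B : algebra) (f : A -> B),
    homomorphism f -> surjective_map f -> V A -> V B;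
  variety_S : forall (A B : algebra) (f : A -> B),
    homomorphism f -> injective_map f -> V B -> V A;
  variety_P : forall (I : Type) (A : I -> algebra),
    (forall i : I, V (A i)) -> V (product A)
}.

Definition generated_variety (K : algebra -> Prop) (L : algebra) : Prop :=
  forall V : algebra -> Prop,
    variety V -> (forall A : algebra, K A -> V A) -> V L.

(* Main.v *)
(* Call e sharp if ◇e = e. The identity says x = (x ∧ e') ∨ (x ∧ e) for every
   sharp e, and its dual says x = (x ∨ e') ∧ (x ∨ e); together they make
   x ∧ e = y ∧ e equivalent to x ∨ e' = y ∨ e', so that this relation is a
   congruence. For a filter F of sharp elements the union of these congruences
   over e in F is again a congruence, and if F contains one of c, c~ for each
   sharp c, then every a in the quotient with a ∧ a' = 0 is 0 or 1, i.e. the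
   quotient is an antiortholattice. By Zorn's lemma such quotients separate
   points, so L embeds into a product of antiortholattices. *)
From Stdlib Require Import ssreflect ClassicalEpsilon.
From mathcomp Require boolp classical_sets.
Require Import Defs.

(** * Order and lattice calculus *)

Section Lattice.

Context {L : algebra} (HL : bounded_lattice L).
Implicit Types x y z : L.

Lemma meet_idem x : x ⊓ x = x.
Proof. by rewrite -{2}(join_meetK HL x x) (meet_joinK HL). Qed.

Lemma le_trans y x z : x ⊑ y -> y ⊑ z -> x ⊑ z.
Proof. by rewrite /le => xy yz; rewrite -{1}xy -(meetA HL) yz. Qed.

Lemma le_antisym x y : x ⊑ y -> y ⊑ x -> x = y.
Proof. by rewrite /le => xy yx; rewrite -xy (meetC HL) yx. Qed.

Lemma meet_le_l x y : x ⊓ y ⊑ x.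
Proof. by rewrite /le (meetC HL) (meetA HL) meet_idem. Qed.

Lemma meet_le_r x y : x ⊓ y ⊑ y.
Proof. by rewrite /le -(meetA HL) meet_idem. Qed.

Lemma le_meet x y z : z ⊑ x -> z ⊑ y -> z ⊑ x ⊓ y.
Proof. by rewrite /le => zx zy; rewrite (meetA HL) zx zy. Qed.

Lemma le_joinE x y : x ⊑ y <-> x ⊔ y = y.
Proof.
split=> [xy | <-]; last exact: meet_joinK HL _ _.
by rewrite -xy (joinC HL) (meetC HL) (join_meetK HL).
Qed.

Lemma le_join_l x y : x ⊑ x ⊔ y.
Proof. exact: meet_joinK HL _ _. Qed.

Lemma le_join_r x y : y ⊑ x ⊔ y.
Proof. by rewrite (joinC HL); exact: le_join_l. Qed.

Lemma join_le x y z : x ⊑ z -> y ⊑ z -> x ⊔ y ⊑ z.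
Proof.
move=> /le_joinE xz /le_joinE yz; apply/le_joinE.
by rewrite -(joinA HL) yz xz.
Qed.

Lemma meet_mono x y z : x ⊑ y -> x ⊓ z ⊑ y ⊓ z.
Proof.
by move=> xy; apply: le_meet (meet_le_r _ _); apply: le_trans xy; exact: meet_le_l.
Qed.

Lemma meet_bot x : x ⊓ bot = bot.
Proof. by rewrite (meetC HL); exact: bot_le HL _. Qed.

Lemma meet_meetr x y z : (x ⊓ y) ⊓ z = (x ⊓ z) ⊓ (y ⊓ z).
Proof.
by rewrite -!(meetA HL) (meetC HL z) -(meetA HL) meet_idem.
Qed.

Lemma join_bot x : x ⊔ bot = x.
Proof. by rewrite (joinC HL); apply/le_joinE; exact: bot_le HL _. Qed.

End Lattice.

(** * De Morgan laws and sharp elements in BZ-lattices *)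

Section BZLattice.

Context {L : algebra} (HL : bz_lattice L).
Implicit Types a b e x y : L.

Lemma kneg_le_swap a b : a ⊑ kneg b -> b ⊑ kneg a.
Proof. by move=> /(kneg_anti HL); rewrite (knegK HL). Qed.

Lemma kneg_meet a b : kneg (a ⊓ b) = kneg a ⊔ kneg b.
Proof.
apply: (le_antisym HL).
- rewrite -[X in _ ⊑ X](knegK HL); apply: (kneg_anti HL); apply: (le_meet HL).
  + by rewrite -[X in _ ⊑ X](knegK HL); apply: (kneg_anti HL); exact: (le_join_l HL).
  + by rewrite -[X in _ ⊑ X](knegK HL); apply: (kneg_anti HL); exact: (le_join_r HL).
- apply: (join_le HL); apply: (kneg_anti HL).
  + exact: (meet_le_l HL).
  + exact: (meet_le_r HL).
Qed.

Lemma kneg_join a b : kneg (a ⊔ b) = kneg a ⊓ kneg b.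
Proof. by rewrite -[RHS](knegK HL) kneg_meet !(knegK HL). Qed.

(** So [bneg] forms an antitone Galois connection with itself, which is why it turns joins into
    meets in [bneg_join]. *)
Lemma bneg_le_swap a b : a ⊑ bneg b -> b ⊑ bneg a.
Proof. by move=> /(bneg_anti HL); apply: (le_trans HL); exact: le_diamond HL b. Qed.

Lemma bneg_join a b : bneg (a ⊔ b) = bneg a ⊓ bneg b.
Proof.
apply: (le_antisym HL).
- apply: (le_meet HL); apply: (bneg_anti HL).
  + exact: (le_join_l HL).
  + exact: (le_join_r HL).
- apply: bneg_le_swap; apply: (join_le HL); apply: bneg_le_swap.
  + exact: (meet_le_l HL).
  + exact: (meet_le_r HL).
Qed.

Lemma bneg3 a : bneg (bneg (bneg a)) = bneg a.
Proof.
apply: (le_antisym HL); last exact: le_diamond HL _.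
by apply: (bneg_anti HL); exact: le_diamond HL _.
Qed.

Lemma diamond_bneg a : diamond (bneg a) = bneg a.
Proof. exact: bneg3. Qed.

Lemma bneg_top : bneg top = bot :> L.
Proof. by rewrite -(meet_bneg HL top) (meetC HL) (le_top HL). Qed.

Lemma bneg_bot : bneg bot = top :> L.
Proof.
rewrite -bneg_top; apply: (le_antisym HL); first exact: le_top HL _.
exact: le_diamond HL _.
Qed.

Lemma diamond_top : diamond top = top :> L.
Proof. by rewrite /diamond bneg_top bneg_bot. Qed.

Lemma kneg_top : kneg top = bot :> L.
Proof. by rewrite -bneg_bot (kneg_bneg HL) bneg_bot bneg_top. Qed.

Lemma kneg_sharp e : diamond e = e -> kneg e = bneg e.
Proof. by move=> <-; rewrite /diamond (kneg_bneg HL). Qed.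

Lemma meet_kneg_sharp e : diamond e = e -> e ⊓ kneg e = bot.
Proof. by move=> /kneg_sharp ->; exact: meet_bneg HL _. Qed.

Lemma diamond_mono a b : a ⊑ b -> diamond a ⊑ diamond b.
Proof. by move=> ab; do 2!apply: (bneg_anti HL). Qed.

(** [diamond] is a closure operator and the sharp elements are its closed elements. *)
Lemma diamond_meet_sharp a b :
  diamond a = a -> diamond b = b -> diamond (a ⊓ b) = a ⊓ b.
Proof.
move=> ha hb; apply: (le_antisym HL); last exact: le_diamond HL _.
apply: (le_meet HL).
- by rewrite -[X in _ ⊑ X]ha; apply: diamond_mono; exact: (meet_le_l HL).
- by rewrite -[X in _ ⊑ X]hb; apply: diamond_mono; exact: (meet_le_r HL).
Qed.

End BZLattice.

(* The star axiom gives ◇a ∧ ◇(a') = 0 here, so paraorthomodularity applies to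
   □a ≤ a. *)
Lemma sharp_of_meet_kneg {L : algebra} (HL : pbzs_lattice L) (a : L) :
  a ⊓ kneg a = bot -> diamond a = a.
Proof.
move=> a0; suff <- : box a = a by exact: (diamond_bneg HL).
apply: (pbzs_paraorthomodular HL).
  rewrite -[X in _ ⊑ X](knegK HL); apply: (kneg_le_swap HL).
  by rewrite (kneg_bneg HL); exact: le_diamond HL _.
have h := pbzs_star HL a; rewrite a0 (bneg_bot HL) in h.
have {}h : bneg a ⊔ box a = top by apply: (le_antisym HL) h; exact: le_top HL _.
have {h} : kneg (bneg a ⊔ box a) = bot by rewrite h (kneg_top HL).
rewrite (kneg_join HL) (kneg_bneg HL) => h.
apply: (le_antisym HL); last exact: bot_le HL _.
rewrite -h (meetC HL (bneg _)); apply: (le_meet HL); first exact: (meet_le_l HL).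
by apply: (le_trans HL) (le_diamond HL a); exact: (meet_le_r HL).
Qed.

(** * BZ axioms in surjective images *)

Section HomomorphicImage.

Context {A B : algebra} {f : A -> B}.
Hypotheses (hf : homomorphism f) (fs : surjective_map f).

Lemma hom_le x y : x ⊑ y -> f x ⊑ f y.
Proof. by rewrite /le -(hom_meet hf) => ->. Qed.

(** Replacing [x] by [x ⊓ y] does not change its image, so an inequality in [B] comes from one in
    [A]. This carries the two antitony axioms over to the image. *)
Lemma hom_le_lift (HA : bounded_lattice A) x y :
  f x ⊑ f y -> exists2 z, z ⊑ y & f z = f x.
Proof.
move=> xy; exists (x ⊓ y); first exact: (meet_le_r HA).
by rewrite (hom_meet hf).
Qed.

Lemma bounded_lattice_image : bounded_lattice A -> bounded_lattice B.
Proof.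
move=> HA; split.
- move=> x y z; case: (fs x) (fs y) (fs z) => [{}x <-] [{}y <-] [{}z <-].
  by rewrite -!(hom_meet hf) (meetA HA).
- move=> x y; case: (fs x) (fs y) => [{}x <-] [{}y <-].
  by rewrite -!(hom_meet hf) (meetC HA).
- move=> x y z; case: (fs x) (fs y) (fs z) => [{}x <-] [{}y <-] [{}z <-].
  by rewrite -!(hom_join hf) (joinA HA).
- move=> x y; case: (fs x) (fs y) => [{}x <-] [{}y <-].
  by rewrite -!(hom_join hf) (joinC HA).
- move=> x y; case: (fs x) (fs y) => [{}x <-] [{}y <-].
  by rewrite -(hom_join hf) -(hom_meet hf) (meet_joinK HA).
- move=> x y; case: (fs x) (fs y) => [{}x <-] [{}y <-].
  by rewrite -(hom_meet hf) -(hom_join hf) (join_meetK HA).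
- move=> x; case: (fs x) => [{}x <-].
  by rewrite -(hom_bot hf); apply: hom_le; exact: bot_le HA _.
- move=> x; case: (fs x) => [{}x <-].
  by rewrite -(hom_top hf); apply: hom_le; exact: le_top HA _.
Qed.

Lemma bz_lattice_image : bz_lattice A -> bz_lattice B.
Proof.
move=> HA; split; first split; first split.
- exact: bounded_lattice_image HA.
- by move=> a; case: (fs a) => [{}a <-]; rewrite -!(hom_kneg hf) (knegK HA).
- move=> a b; case: (fs a) (fs b) => [{}a <-] [{}b <-].
  move=> /(hom_le_lift HA) [c cb <-].
  by rewrite -!(hom_kneg hf); apply: hom_le; exact: kneg_anti HA _ _ cb.
- move=> a b; case: (fs a) (fs b) => [{}a <-] [{}b <-].
  rewrite -!(hom_kneg hf) -(hom_meet hf) -(hom_join hf).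
  by apply: hom_le; exact: kleene HA _ _.
- move=> a; case: (fs a) => [{}a <-].
  by rewrite -(hom_bneg hf) -(hom_meet hf) (meet_bneg HA) (hom_bot hf).
- move=> a; case: (fs a) => [{}a <-].
  by rewrite -!(hom_bneg hf); apply: hom_le; exact: le_diamond HA _.
- move=> a b; case: (fs a) (fs b) => [{}a <-] [{}b <-].
  move=> /(hom_le_lift HA) [c cb <-].
  by rewrite -!(hom_bneg hf); apply: hom_le; exact: bneg_anti HA _ _ cb.
- move=> a; case: (fs a) => [{}a <-].
  by rewrite -!(hom_bneg hf) -(hom_kneg hf) (kneg_bneg HA).
Qed.

End HomomorphicImage.

(** * Congruences and quotient algebras *)

Record congruence {L : algebra} (R : L -> L -> Prop) : Prop := {
  cong_refl : forall x, R x x;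
  cong_sym : forall x y, R x y -> R y x;
  cong_trans : forall y x z, R x y -> R y z -> R x z;
  cong_meet : forall x x' y y', R x x' -> R y y' -> R (x ⊓ y) (x' ⊓ y');
  cong_join : forall x x' y y', R x x' -> R y y' -> R (x ⊔ y) (x' ⊔ y');
  cong_kneg : forall x y, R x y -> R (kneg x) (kneg y);
  cong_bneg : forall x y, R x y -> R (bneg x) (bneg y)
}.

Arguments cong_refl {L R}.
Arguments cong_sym {L R}.
Arguments cong_trans {L R}.
Arguments cong_meet {L R}.
Arguments cong_join {L R}.
Arguments cong_kneg {L R}.
Arguments cong_bneg {L R}.

Section Quotient.

Context {L : algebra} (R : L -> L -> Prop).

(** Related elements have extensionally equal predicates [R x], hence receive the same choice; [bot]
    only witnesses that the carrier is inhabited. *)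
Definition representative (x : L) : L := epsilon (inhabits bot) (R x).

(* Classes are encoded by their chosen representatives. *)
Definition quotient_carrier : Type := {r : L | exists x, r = representative x}.

Definition quotient_class (x : L) : quotient_carrier :=
  exist _ (representative x) (ex_intro _ x eq_refl).

Definition quotient : algebra := {|
  carrier := quotient_carrier;
  meet := fun p q => quotient_class (proj1_sig p ⊓ proj1_sig q);
  join := fun p q => quotient_class (proj1_sig p ⊔ proj1_sig q);
  kneg := fun p => quotient_class (kneg (proj1_sig p));
  bneg := fun p => quotient_class (bneg (proj1_sig p));
  bot := quotient_class bot;
  top := quotient_class top
|}.

Definition proj (x : L) : quotient := quotient_class x.

Hypothesis HR : congruence R.

Lemma representativeP x : R x (representative x).
Proof. by apply: epsilon_spec; exists x; exact: cong_refl HR x. Qed.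

Lemma quotient_eq (p q : quotient) : proj1_sig p = proj1_sig q -> p = q.
Proof.
case: p q => [p hp] [q hq] /= pq; subst q.
by rewrite (boolp.Prop_irrelevance hp hq).
Qed.

Lemma projP x y : proj x = proj y <-> R x y.
Proof.
split=> [/(f_equal (@proj1_sig _ _)) /= xy | xy].
- apply: (cong_trans HR _ _ _ (representativeP x)); rewrite xy.
  by apply: (cong_sym HR); exact: representativeP.
- apply: quotient_eq => /=; rewrite /representative; congr epsilon.
  apply: boolp.funext => z; apply: boolp.propext; split.
  + by move=> xz; apply: (cong_trans HR) xz; exact: (cong_sym HR).
  + by move=> yz; apply: (cong_trans HR) xy yz.
Qed.

Lemma proj_surjective : surjective_map proj.
Proof. by case=> r [x hx]; exists x; apply: quotient_eq. Qed.

Lemma proj_hom : homomorphism proj.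
Proof.
have h := representativeP; split=> // *; apply/projP.
- exact: (cong_meet HR).
- exact: (cong_join HR).
- exact: (cong_kneg HR).
- exact: (cong_bneg HR).
Qed.

End Quotient.

(** * Prime filters of sharp elements and their quotients *)

Record prime_filter {L : algebra} (F : L -> Prop) : Prop := {
  pf_sharp : forall e, F e -> diamond e = e;
  pf_top : F top;
  pf_meet : forall e f, F e -> F f -> F (e ⊓ f);
  pf_prime : forall c, diamond c = c -> F c \/ F (bneg c)
}.

Arguments pf_sharp {L F}.
Arguments pf_top {L F}.
Arguments pf_meet {L F}.
Arguments pf_prime {L F}.

(** The analogue of equality almost everywhere in a reduced product, the members of [F] acting as
    the large sets. *)
Definition filter_rel {L : algebra} (F : L -> Prop) (x y : L) : Prop :=
  exists2 e, F e & x ⊓ e = y ⊓ e.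

Section Decomposition.

Context {L : algebra} (HL : pbzs_lattice L).
Hypothesis Hid : forall x y : L, x = (x ⊓ bneg y) ⊔ (x ⊓ diamond y).
Implicit Types a b c e f x y : L.

Lemma meet_decomp e x : diamond e = e -> x = (x ⊓ kneg e) ⊔ (x ⊓ e).
Proof. by move=> he; rewrite {1}(Hid x e) (kneg_sharp HL) he. Qed.

Lemma join_decomp e x : diamond e = e -> x = (x ⊔ e) ⊓ (x ⊔ kneg e).
Proof.
move=> he; rewrite -{1}(knegK HL x) {1}(meet_decomp e (kneg x) he).
by rewrite (kneg_join HL) !(kneg_meet HL) !(knegK HL).
Qed.

(** Expand [x] on the right by [join_decomp]; the factor [x ⊔ e] lies above [e] and is absorbed. *)
Lemma join_meet_sharp e x : diamond e = e -> (x ⊔ kneg e) ⊓ e = x ⊓ e.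
Proof.
move=> he; rewrite {2}(join_decomp e x he) (meetC HL (x ⊔ e)) -(meetA HL).
by rewrite (meetC HL (x ⊔ e)) (joinC HL x e) (meet_joinK HL).
Qed.

Lemma meet_join_sharp e x : diamond e = e -> (x ⊓ e) ⊔ kneg e = x ⊔ kneg e.
Proof.
move=> he; rewrite {2}(meet_decomp e x he) (joinC HL (x ⊓ kneg e)) -(joinA HL).
by rewrite (joinC HL (x ⊓ kneg e)) (meetC HL x (kneg e)) (join_meetK HL).
Qed.

Lemma meet_sharp_eqE e x y :
  diamond e = e -> x ⊓ e = y ⊓ e <-> x ⊔ kneg e = y ⊔ kneg e.
Proof.
move=> he; split=> h.
- by rewrite -(meet_join_sharp _ x he) h meet_join_sharp.
- by rewrite -(join_meet_sharp _ x he) h join_meet_sharp.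
Qed.

(** Meets respect the form with [⊓ e], joins the form with [⊔ kneg e]. De Morgan makes [kneg] carry
    the first form to the second, and [bneg] carries the second back to the first because
    [bneg (kneg e) = e]. *)
Lemma meet_sharp_congruence e :
  diamond e = e -> congruence (fun x y : L => x ⊓ e = y ⊓ e).
Proof.
move=> he; split=> //.
- by move=> y x z -> ->.
- by move=> x x' y y' xx yy; rewrite !(meet_meetr HL _ _ e) xx yy.
- move=> x x' y y' /(meet_sharp_eqE _ _ _ he) xx /(meet_sharp_eqE _ _ _ he) yy.
  by apply/(meet_sharp_eqE _ _ _ he); rewrite -!(joinA HL) yy (joinC HL y')
    (joinA HL) xx -(joinA HL) (joinC HL _ y').
- move=> x y xy; apply/(meet_sharp_eqE _ _ _ he).
  by rewrite -!(kneg_meet HL) xy.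
- move=> x y /(meet_sharp_eqE _ _ _ he) /(f_equal bneg).
  by rewrite !(bneg_join HL) (kneg_sharp HL _ he) -/(diamond e) he.
Qed.

Lemma meet_sharp_weaken e f x y : x ⊓ e = y ⊓ e -> x ⊓ (e ⊓ f) = y ⊓ (e ⊓ f).
Proof. by rewrite !(meetA HL) => ->. Qed.

(** Complementing relative to [e] commutes with truncation to [e], so computations with [kneg] can
    be done below [e]. *)
Lemma kneg_meet_sharp e x : diamond e = e -> kneg (x ⊓ e) ⊓ e = kneg x ⊓ e.
Proof. by move=> he; rewrite (kneg_meet HL) join_meet_sharp. Qed.

Section PrimeFilter.

Context {F : L -> Prop} (HF : prime_filter F).

Lemma filter_rel_congruence : congruence (filter_rel F).
Proof.
(* Two relations with separate witnesses hold together on the meet of the witnesses, so the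
   congruence of one sharp element suffices. *)
have common x x' y y' : filter_rel F x x' -> filter_rel F y y' ->
    exists2 e, F e & x ⊓ e = x' ⊓ e /\ y ⊓ e = y' ⊓ e.
  move=> [e Fe xe] [f Ff yf]; exists (e ⊓ f); first exact: pf_meet HF _ _ Fe Ff.
  split; first exact: meet_sharp_weaken.
  by rewrite (meetC HL e); exact: meet_sharp_weaken.
have C e (Fe : F e) := meet_sharp_congruence e (pf_sharp HF _ Fe).
split.
- by move=> x; exists top => //; exact: pf_top HF.
- by move=> x y [e Fe xy]; exists e.
- move=> y x z xy yz; have [e Fe [h1 h2]] := common _ _ _ _ xy yz.
  by exists e; rewrite // h1.
- move=> x x' y y' xx yy; have [e Fe [h1 h2]] := common _ _ _ _ xx yy.
  by exists e => //; exact: cong_meet (C e Fe) _ _ _ _ h1 h2.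
- move=> x x' y y' xx yy; have [e Fe [h1 h2]] := common _ _ _ _ xx yy.
  by exists e => //; exact: cong_join (C e Fe) _ _ _ _ h1 h2.
- by move=> x y [e Fe xy]; exists e => //; exact: cong_kneg (C e Fe) _ _ xy.
- by move=> x y [e Fe xy]; exists e => //; exact: cong_bneg (C e Fe) _ _ xy.
Qed.

Let hom := proj_hom _ filter_rel_congruence.
Let surj := proj_surjective (filter_rel F).
Let projE x y := projP _ filter_rel_congruence x y.

(* Truncating representatives by some e in F turns both conditional axioms in
   the quotient into instances of their counterparts in L. *)
Lemma quotient_antiortholattice : antiortholattice (quotient (filter_rel F)).
Proof.
have HQ := bz_lattice_image hom surj HL.
split; first split => //.
- move=> a; case: (surj a) => [{}a <-]; rewrite /box.
  rewrite -!(hom_kneg hom) -!(hom_meet hom) -!(hom_bneg hom) -!(hom_join hom).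
  by apply: (hom_le hom); exact: pbzs_star HL a.
- move=> a b; case: (surj a) (surj b) => [{}a <-] [{}b <-] ab.
  rewrite -(hom_kneg hom) -(hom_meet hom) -(hom_bot hom) => /projE [f Ff ab0].
  move: ab; rewrite /le -(hom_meet hom) => /projE [e Fe ab].
  have Fg := pf_meet HF _ _ Fe Ff; set g := e ⊓ f in Fg.
  have hg := pf_sharp HF _ Fg.
  have {}ab : (a ⊓ b) ⊓ g = a ⊓ g by exact: meet_sharp_weaken.
  have {}ab0 : (kneg a ⊓ b) ⊓ g = bot.
    rewrite /g (meetC HL e) (meet_sharp_weaken _ _ _ _ ab0).
    by rewrite (meetC HL) (meet_bot HL).
  apply/projE; exists g => //; apply: (pbzs_paraorthomodular HL).
    by rewrite -ab; apply: (meet_mono HL); exact: (meet_le_r HL).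
  by rewrite (meetC HL b) (meetA HL) kneg_meet_sharp // -(meetA HL) (meetC HL g)
    (meetA HL).
- move=> a; case: (surj a) => [{}a <-]; split=> [|[->|->]]; last first.
  + by rewrite (kneg_top HQ) (meet_bot HQ).
  + by rewrite (meetC HQ) (meet_bot HQ).
  rewrite -(hom_kneg hom) -(hom_meet hom) -(hom_bot hom) -(hom_top hom).
  move=> /projE [e Fe]; have he := pf_sharp HF _ Fe.
  rewrite (meetC HL bot) (meet_bot HL) => a0.
  (* [a] itself need not be sharp, but its truncation meets its own [kneg] in [bot], so primeness
     applies to [a ⊓ e]. *)
  have hs : diamond (a ⊓ e) = a ⊓ e.
    apply: (sharp_of_meet_kneg HL).
    by rewrite -(meetA HL) (meetC HL e) kneg_meet_sharp // (meetA HL).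
  (* On [a ⊓ e] the element [a] agrees with [top]; on [e ⊓ bneg (a ⊓ e)] it agrees with [bot]. *)
  case: (pf_prime HF _ hs) => Fa; [right | left]; apply/projE.
  + exists (a ⊓ e) => //; rewrite (meetA HL) (meet_idem HL) (meetC HL top).
    by rewrite (le_top HL).
  + exists (e ⊓ bneg (a ⊓ e)); first exact: pf_meet HF _ _ Fe Fa.
    by rewrite (meetA HL) (meet_bneg HL) (meetC HL bot) (meet_bot HL).
Qed.

End PrimeFilter.

(** No clause puts [top] in [G], because Zorn's lemma is applied to all chains, including the empty
    one, whose union is empty. *)
Definition separating_sharp_family (x y : L) (G : L -> Prop) : Prop :=
  (forall e, G e -> diamond e = e) /\
  (forall e f, G e -> G f -> G (e ⊓ f)) /\
  (forall e, G e -> x ⊓ e <> y ⊓ e).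

(** A maximal separating family is prime: if it omitted both [c] and [bneg c], adjoining either
    would identify [x] and [y] on some member cut by it, and the splitting along [c] would glue
    these two agreements into one on a member. *)
Lemma prime_filter_separation x y :
  x <> y -> exists2 F, prime_filter F & ~ filter_rel F x y.
Proof.
move=> xy.
have [|G [[Gs [Gm Gxy]] Gmax]] :=
    @classical_sets.Zorn_bigcup _ (separating_sharp_family x y).
  move=> C CP Ctot; split; last split.
  - by move=> e [X CX Xe]; exact: (proj1 (CP X CX)) e Xe.
  - move=> e f [X CX Xe] [Y CY Yf]; case: (Ctot X Y CX CY) => XY.
    + by exists Y => //; apply: (proj1 (proj2 (CP Y CY))) => //; exact: XY.
    + by exists X => //; apply: (proj1 (proj2 (CP X CX))) => //; exact: XY.
  - by move=> e [X CX Xe]; exact: (proj2 (proj2 (CP X CX))) e Xe.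
(* The maximal family is completed by [top], which still separates [x] from [y]. *)
pose F e := G e \/ e = top.
have Fs e : F e -> diamond e = e by move=> [/Gs|->] //; exact: (diamond_top HL).
have Fm e f : F e -> F f -> F (e ⊓ f).
  move=> [Ge|->] [Gf|->]; rewrite ?(le_top HL) ?(meetC HL top) ?(le_top HL).
  - by left; exact: Gm.
  - by left.
  - by left.
  - by right.
have Fxy e : F e -> x ⊓ e <> y ⊓ e by move=> [/Gxy|->] //; rewrite !(le_top HL).
have adjoin c : diamond c = c -> ~ G c ->
    exists2 e, F e & x ⊓ (e ⊓ c) = y ⊓ (e ⊓ c).
  move=> hc nGc; apply: NNPP => none.
  (* The meet-closed family generated by [G] and [c]; it contains [c] as [top ⊓ c]. Without a
     suitable [e] it would be a strictly larger separating family. *)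
  pose G' e := G e \/ exists2 f, F f & e = f ⊓ c.
  apply: (Gmax G').
    split=> [e Ge | sub]; first by left.
    apply: nGc; apply: sub; right; exists top; first by right.
    by rewrite (meetC HL) (le_top HL).
  split; last split.
  - by move=> e [/Gs//|[f Ff ->]]; apply: (diamond_meet_sharp HL) hc; exact: Fs.
  - move=> e f [Ge|[e1 Fe ->]] [Gf|[f1 Ff ->]].
    + by left; exact: Gm.
    + right; exists (e ⊓ f1); last by rewrite (meetA HL).
      by apply: Fm => //; left.
    + right; exists (e1 ⊓ f); last by rewrite -!(meetA HL) (meetC HL c).
      by apply: Fm => //; left.
    + right; exists (e1 ⊓ f1); first exact: Fm.
      by rewrite -!(meetA HL) (meetC HL c) -(meetA HL) (meet_idem HL).
  - by move=> e [/Gxy//|[f Ff ->]] E; apply: none; exists f.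
exists F; last by move=> [e /Fxy].
split=> //; first by right.
move=> c hc; apply: NNPP => nF.
have [|e Fe xye] := adjoin c hc; first by move=> Gc; apply: nF; do 2!left.
have [|f Ff xyf] := adjoin (bneg c) (diamond_bneg HL c).
  by move=> Gc; apply: nF; right; left.
(* The part of [x ⊓ (e ⊓ f)] under [c] is controlled by [xye], the part under [bneg c] by [xyf]. *)
apply: (Fxy (e ⊓ f)); first exact: Fm.
rewrite (meet_decomp c (x ⊓ _) hc) (meet_decomp c (y ⊓ _) hc) (kneg_sharp HL _ hc).
congr (_ ⊔ _).
- rewrite -!(meetA HL) (meetC HL e) !(meetA HL); move: xyf.
  by rewrite !(meetA HL) => ->.
- by rewrite -!(meetA HL) (meetC HL f) !(meetA HL); move: xye; rewrite !(meetA HL) => ->.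
Qed.

End Decomposition.

(** * The variety defined by the identity, and the equivalence *)

Definition splitting_identity (L : algebra) : Prop :=
  forall x y : L, x = (x ⊓ bneg y) ⊔ (x ⊓ diamond y).

Lemma splitting_identity_variety : variety splitting_identity.
Proof.
split.
- move=> A B f hf fs HA x y; case: (fs x) (fs y) => [{}x <-] [{}y <-].
  by rewrite /diamond -!(hom_bneg hf) -!(hom_meet hf) -(hom_join hf); congr f.
- move=> A B f hf fi HB x y; apply: fi.
  by rewrite (hom_join hf) !(hom_meet hf) /diamond !(hom_bneg hf); exact: HB.
- by move=> I A HA x y; apply: boolp.functional_extensionality_dep => i; exact: HA.
Qed.

(** [bneg y] is sharp, hence [bot] or [top]; then one joinand is [x] and the other is [bot]. *)
Lemma antiortholattice_splitting (A : algebra) :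
  antiortholattice A -> splitting_identity A.
Proof.
move=> HA x y.
have /(aol_sharp HA) := meet_kneg_sharp HA _ (diamond_bneg HA y).
rewrite /diamond; case=> ->.
- by rewrite (bneg_bot HA) (meet_bot HA) (le_top HA) (joinC HA) (join_bot HA).
- by rewrite (bneg_top HA) (meet_bot HA) (le_top HA) (join_bot HA).
Qed.

Theorem theorem59 (L : algebra) (HL : pbzs_lattice L) :
  generated_variety antiortholattice L <->
  (forall x y : L, x = (x ⊓ bneg y) ⊔ (x ⊓ diamond y)).
Proof.
split=> [gen | Hid].
  exact: gen splitting_identity_variety antiortholattice_splitting.
move=> V HV AV.
(* The factors are indexed by all prime filters of [L], so that every pair of distinct elements is
   separated in some coordinate. *)
pose A (F : {F : L -> Prop | prime_filter F}) := quotient (filter_rel (proj1_sig F)).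
have C (F : {F : L -> Prop | prime_filter F}) :=
  filter_rel_congruence HL Hid (proj2_sig F).
pose f (x : L) : product A := fun F => proj (filter_rel (proj1_sig F)) x.
apply: (variety_S HV (B := product A) (f := f)).
- have h F := proj_hom _ (C F).
  split=> *; apply: boolp.functional_extensionality_dep => F.
  + exact: hom_meet (h F) _ _.
  + exact: hom_join (h F) _ _.
  + exact: hom_kneg (h F) _.
  + exact: hom_bneg (h F) _.
  + exact: hom_bot (h F).
  + exact: hom_top (h F).
- move=> x y fxy; apply: NNPP => xy.
  have [F HF] := prime_filter_separation HL Hid x y xy; apply.
  apply/(projP _ (C (exist _ F HF))).
  exact: (f_equal (fun g : product A => g (exist _ F HF)) fxy).
- apply: (variety_P HV) => F; apply: AV.
  exact: (quotient_antiortholattice HL Hid (proj2_sig F)).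
Qed.
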